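(* Let $n\ge 1$ be an integer and let $G=D_{2n}$ be the dihedral group of order $2n$. Then $$\mathcal{V}(G)=\frac{n+\omega(n)}{\tau(n)+\sigma(n)}.$$
   Context: For a finite group $G$, $L(G)$ denotes the set of all subgroups of $G$ (including the trivial subgroup and $G$ itself), $s(G)$ denotes the number of subgroups of $G$ that are simple groups (the trivial group is not simple; cyclic groups of prime order are simple), and $\mathcal{V}(G)=s(G)/|L(G)|$. Subgroups are counted as subsets of $G$. $D_{2n}=\langle r,s\mid r^n=s^2=1,\ srs=r^{-1}\rangle$. For a positive integer $m$: $\omega(m)$ is the number of distinct prime factors of $m$, $\tau(m)$ the number of positive divisors of $m$, and $\sigma(m)$ the sum of the positive divisors of $m$. *)

(* Defs.v *)
From HB Require Import structures.
From mathcomp Require Import all_boot all_order all_algebra.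
From mathcomp Require Import all_fingroup all_solvable.

Set Implicit Arguments.
Unset Strict Implicit.
Unset Printing Implicit Defensive.

Import GroupScope.

(* The library's group 'D_(2 * n) is dihedral of order 2n only for n > 1
   ('D_2 has order 4, since 'Z_1 is Z/2Z); the presentation also covers the
   degenerate case n = 1. *)
Definition is_dihedral (n : nat) (gT : finGroupType) (G : {group gT}) : Prop :=
  G \isog Grp (r : s : (r ^+ n, s ^+ 2, s * r * s = r^-1)).

Definition num_simple_subgroups (gT : finGroupType) (G : {group gT}) : nat :=
  #|[set H in subgroups G | simple H]|.

Definition simple_ratio (gT : finGroupType) (G : {group gT}) : rat :=
  ((num_simple_subgroups G)%:R / #|subgroups G|%:R)%R.

Definition omega (m : nat) : nat := size (primes m).

Definition tau (m : nat) : nat := size (divisors m).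

Definition sigma (m : nat) : nat := (\sum_(d <- divisors m) d)%N.

(* Main.v *)
(* Write R for the rotation subgroup.  A subgroup H not contained in R meets R
   in some D of half its order, and H is generated by D together with any
   involution of H \ R.  Each such H accounts for |D| of the n involutions
   outside R, so there are n / |D| subgroups H over a given D.  As R has exactly
   one subgroup of each order d dividing n, a sum of F(|H|) over the subgroups
   of G is the sum over d | n of F(d) + (n / d) F(2d); taking F = 1 counts the
   subgroups, and taking for F the indicator of the primes counts the simple
   ones, since G is solvable. *)

Require Import Defs.
From HB Require Import structures.
From mathcomp Require Import all_boot all_order all_algebra.
From mathcomp Require Import all_fingroup all_solvable.

Set Implicit Arguments.
Unset Strict Implicit.
Unset Printing Implicit Defensive.

Import GroupScope.

Lemma simple_sol_primeE (gT : finGroupType) (G : {group gT}) :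
  solvable G -> simple G = prime #|G|.
Proof.
move=> solG; apply/idP/idP=> [|prG]; first exact: simple_sol_prime.
apply/simpleP; split=> [|H /andP[sHG _]].
  by apply: contraTneq prG => ->; rewrite cards1.
have [|ntH] := eqVneq (H :&: G) 1; first by rewrite (setIidPl sHG); left.
right; apply/eqP; rewrite eqEsubset sHG /=; apply: contraR ntH => nsGH.
by rewrite setIC (prime_TIg prG nsGH).
Qed.

(** Taking orders is a bijection from the subgroups of a cyclic group onto the divisors of its
    order. *)
Lemma sum_cyclic_subgroups (gT : finGroupType) (R : {group gT}) F :
  cyclic R ->
  \sum_(D in subgroups R) F #|D| = \sum_(d <- divisors #|R|) F d.
Proof.
move=> cycR; rewrite -(big_image _ _ _ (mem (subgroups R))) /=.
apply/perm_big/uniq_perm; last 1 first.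
- move=> d; rewrite -dvdn_divisors //; apply/imageP/idP=> [[D] | dR].
    by rewrite inE => sDR ->; apply: cardSg.
  have [r defR] := cyclicP cycR; rewrite defR in dR *.
  have := cycle_sub_group dR.
  move/setP/(_ <[r ^+ (#[r] %/ d)]>%G); rewrite !inE eqxx => /andP[sDR /eqP oD].
  by exists <[r ^+ (#[r] %/ d)]>%G; rewrite ?inE.
- rewrite map_inj_in_uniq ?enum_uniq // => D E.
  rewrite !mem_enum !inE => sDR sER /eqP.
  by rewrite -(eq_subG_cyclic cycR) // => /eqP/val_inj.
- exact: divisors_uniq.
Qed.

Section OutsideInvolutions.

Variables (gT : finGroupType) (G R : {group gT}).
Hypotheses (sRG : R \subset G) (indexR : #|G : R| = 2).
Hypothesis invol : {in G :\: R, forall x, x ^+ 2 = 1}.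

(** Both [x] and [a * x] lie outside [R], so both square to 1, and [(a * x) ^+ 2 = 1] rearranges to
    the claim. *)
Lemma conjg_outside x a : x \in G :\: R -> a \in R -> a ^ x = a^-1.
Proof.
move=> GRx Ra; have /setDP[Gx notRx] := GRx.
have: (a * x) ^+ 2 = 1.
  by apply: invol; rewrite inE !groupMl ?notRx ?Gx // (subsetP sRG).
have xV: x^-1 = x by apply/eqP; rewrite eq_invg_mul -expg2 invol.
by rewrite expg2 conjgE xV -!mulgA => /eqP; rewrite -eq_invg_mul => /eqP.
Qed.

Lemma order_outside x : x \in G :\: R -> #[x] = 2.
Proof.
move=> GRx; have /setDP[_ notRx] := GRx.
by apply: nt_prime_order => //; [apply: invol | apply: contraNneq notRx => ->].
Qed.

Lemma TI_outside x : x \in G :\: R -> R :&: <[x]> = 1.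
Proof.
move=> GRx; have /setDP[_ notRx] := GRx.
by rewrite setIC; apply: prime_TIg; rewrite ?cycle_subG // -orderE order_outside.
Qed.

Lemma mulg_outside x : x \in G :\: R -> R * <[x]> = G.
Proof.
move=> GRx; have /setDP[Gx _] := GRx.
apply/eqP; rewrite eqEcard mul_subG ?cycle_subG //=.
by rewrite TI_cardMg ?TI_outside // -orderE order_outside // -(Lagrange sRG) indexR.
Qed.

(** Since [x] inverts every element of [D], it normalizes [D]. *)
Lemma joing_outside (D : {group gT}) x :
  D \subset R -> x \in G :\: R -> D <*> <[x]> = D * <[x]>.
Proof.
move=> sDR GRx; apply: norm_joinEr; rewrite cycle_subG inE.
apply/subsetP=> _ /imsetP[a Da ->].
by rewrite (conjg_outside GRx) ?groupV // (subsetP sDR).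
Qed.

Lemma setI_mulg_outside (D : {group gT}) x :
  D \subset R -> x \in G :\: R -> D * <[x]> :&: R = D.
Proof.
by move=> sDR GRx; rewrite -group_modl // [_ :&: R]setIC TI_outside // mulg1.
Qed.

(** Dedekind's modular law, applied to [H] and the factorization [R * <[x]>] of [G]. *)
Lemma subgroup_outside (H : {group gT}) x :
  H \subset G -> x \in H :\: R -> H :=: (H :&: R) * <[x]>.
Proof.
move=> sHG /setDP[Hx notRx]; rewrite group_modr ?cycle_subG //.
by rewrite mulg_outside ?(setIidPl sHG) // inE notRx (subsetP sHG).
Qed.

Lemma card_subgroup_outside (H : {group gT}) :
  H \subset G -> ~~ (H \subset R) -> #|H| = (2 * #|H :&: R|)%N.
Proof.
move=> sHG /subsetPn[x Hx notRx]; have GRx: x \in G :\: R.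
  by rewrite inE notRx (subsetP sHG).
rewrite {1}(subgroup_outside sHG (x := x)) ?inE ?notRx // TI_cardMg.
  by rewrite -orderE order_outside // mulnC.
by apply/trivgP; rewrite -(TI_outside GRx) setSI // subsetIr.
Qed.

Definition subgroups_over (D : {set gT}) :=
  [set H in subgroups G | ~~ (H \subset R) && (H :&: R == D)].

(** The elements [x] of [G :\: R], as many as those of [R], are sorted by the subgroup [D <*>
    <[x]>]. The fibre over [H] is [H :\: R], which has [#|D|] elements because [D] is half of
    [H]. *)
Lemma card_subgroups_over (D : {group gT}) :
  D \subset R -> (#|subgroups_over D| * #|D|)%N = #|R|.
Proof.
move=> sDR; have oGR: #|G :\: R| = #|R|.
  by rewrite cardsD (setIidPr sRG) -(Lagrange sRG) indexR muln2 -addnn addnK.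
rewrite -[RHS]oGR -[RHS]sum1_card.
rewrite (partition_big (fun x => D <*> <[x]>)%G [in subgroups_over D]) /=.
  rewrite -sum_nat_const; apply: eq_bigr => H; rewrite !inE.
  case/and3P=> sHG nsHR /eqP defD; rewrite sum1_card.
  have /eqP := card_subgroup_outside sHG nsHR.
  rewrite -(cardsID R H) defD mul2n -addnn eqn_add2l => /eqP <-.
  apply: eq_card => x; rewrite !inE; apply/andP/andP=> [[notRx Hx] | [GRx]].
    have GRx: x \in G :\: R by rewrite inE notRx (subsetP sHG).
    split=> //.
    rewrite -val_eqE /= joing_outside // -defD -subgroup_outside //.
    by rewrite inE notRx.
  move/eqP <-; case/setDP: GRx => _ ->; split=> //.
  by rewrite mem_gen // inE cycle_id orbT.
move=> x GRx; have /setDP[Gx notRx] := GRx.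
rewrite !inE join_subG cycle_subG Gx (subset_trans sDR sRG) /=.
rewrite joing_outside // setI_mulg_outside // eqxx andbT.
by apply: contra notRx => /subsetP; apply; rewrite -{1}(mul1g x) mem_mulg ?cycle_id.
Qed.

(** Subgroups are grouped by their intersection [D] with [R]: one of them is [D] itself, the others
    form [subgroups_over D] and have order [2 * #|D|]. *)
Lemma sum_subgroups F :
  \sum_(H in subgroups G) F #|H| =
  \sum_(D in subgroups R) (F #|D| + #|R| %/ #|D| * F (2 * #|D|))%N.
Proof.
have eqG (A B : {group gT}) : (A == B) = (A :==: B) by [].
rewrite (partition_big (fun H => H :&: R)%G [in subgroups R]) /=; last first.
  by move=> H _; rewrite inE subsetIr.
apply: eq_bigr => D; rewrite inE => sDR.
rewrite (bigID (fun H : {group gT} => H \subset R)) /=; congr (_ + _)%N.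
  rewrite (big_pred1 D) // => H; rewrite inE !eqG /=.
  apply/andP/eqP=> [[/andP[_ /eqP defD] sHR] | ->].
    by apply: group_inj; rewrite -defD (setIidPl sHR).
  by rewrite (setIidPl sDR) eqxx (subset_trans sDR sRG).
rewrite -(card_subgroups_over sDR) mulnK // -sum_nat_const.
apply: eq_big => [H | H /andP[/andP[]]]; rewrite !inE ?eqG.
  by rewrite -andbA [(_ == _) && _]andbC.
by move=> sHG /eqP <- nsHR; rewrite -card_subgroup_outside.
Qed.

End OutsideInvolutions.

(** A concrete image of the presented group, which bounds the order of that group from below by
    [2 * n]. *)
Lemma dihedral_model n : 1 <= n ->
  exists (rT : finGroupType) (M : {group rT}), #|M| = (2 * n)%N /\
    M \homg Grp (r : s : (r ^+ n, s ^+ 2, s * r * s = r^-1)).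
Proof.
rewrite leq_eqVlt => /predU1P[<- | n_gt1].
  exists 'Z_2, [set: 'Z_2]%G; rewrite cardsT card_ord; split=> //.
  apply/existsP; exists (1, Zp1 : 'Z_2).
  rewrite /= !xpair_eqE /= cycle1 joing1G eqEcard subsetT cardsT card_ord.
  by rewrite -orderE order_Zp1.
exists ('D_(n.*2))%type, 'D_(n.*2)%G.
rewrite (card_dihedral n_gt1) mul2n; split=> //.
have /isoGrp_hom/existsP[[r s]] := Grp_dihedral n_gt1.
rewrite /= !xpair_eqE => /and4P[defD r_n /eqP s2 r_s].
apply/existsP; exists (r, s); rewrite /= !xpair_eqE defD r_n s2 eqxx /=.
(* The known presentation of ['D_(n.*2)] has the relation [r ^ s = r^-1]; as [s] is its own inverse,
   [r ^ s] is [s * r * s]. *)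
have /eqP sV: s^-1 == s by rewrite eq_invg_mul -expg2 s2.
by rewrite -{1}sV -mulgA -conjgE.
Qed.

(** The relations give [#[r] <= n], [#[s] <= 2] and [#|G| <= #[r] * #[s]]; the model gives
    [2 * n <= #|G|], so equality holds throughout and [R] is [<[r]>]. *)
Lemma is_dihedralP n (gT : finGroupType) (G : {group gT}) :
  1 <= n -> is_dihedral n G -> exists R : {group gT},
    [/\ R \subset G, #|G : R| = 2, #|R| = n, cyclic R
       & {in G :\: R, forall x, x ^+ 2 = 1}].
Proof.
move=> n_gt0 dihG; have oG_ge: 2 * n <= #|G|.
  have [rT [M [<- homM]]] := dihedral_model n_gt0.
  by apply: leq_homg; rewrite dihG.
have /isoGrp_hom/existsP[[r s]] := dihG.
rewrite /= !xpair_eqE => /and4P[/eqP defG /eqP rn /eqP s2 /eqP srs].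
have sV: s^-1 = s by apply/eqP; rewrite eq_invg_mul -expg2 s2.
have rs: r ^ s = r^-1 by rewrite conjgE sV mulgA.
have nRs: <[s]> \subset 'N(<[r]>).
  by rewrite cycle_subG inE -cycleJ rs cycleV.
rewrite norm_joinEr // in defG.
have or_le: #[r] <= n by rewrite dvdn_leq // order_dvdn rn.
have os_le: #[s] <= 2 by rewrite dvdn_leq // order_dvdn s2.
have oG_le: #|G| <= #[r] * #[s].
  by rewrite -defG !orderE mul_cardG leq_pmulr.
have or: #[r] = n.
  apply/eqP; rewrite eqn_leq or_le -(leq_pmul2l (isT : 0 < 2)).
  by rewrite (leq_trans oG_ge) // (leq_trans oG_le) // mulnC leq_mul2r os_le orbT.
have sRG: <[r]> \subset G by rewrite -defG mulG_subl.
exists <[r]>%G; split; rewrite ?cycle_cyclic //=.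
  have oG: #|G| = (2 * n)%N.
    apply/eqP; rewrite eqn_leq oG_ge andbT (leq_trans oG_le) //.
    by rewrite or mulnC leq_mul2r os_le orbT.
  by rewrite -divgS // -orderE or oG mulnK.
move=> x; rewrite -defG => /setDP[/mulsgP[a t Ra /cycleP[i ->] ->]].
(* Only the parity of [i] matters: an even [i] would put the element in [<[r]>], and for odd [i] its
   square is [a * a ^ s], which is 1. *)
rewrite groupMl // -{1 2}(odd_double_half i) expgD -mul2n expgM s2 expg1n mulg1.
case: (odd i) => [_|]; last by rewrite group1.
rewrite !expg1 expg2 -mulgA; have /cycleP[k ->] := Ra.
by rewrite -{1}sV -conjgE conjXg rs expgVn mulgV.
Qed.

(** The map sending [d] to [n %/ d] permutes the divisors of [n]. *)
Lemma sum_divn_divisors n :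
  0 < n -> \sum_(d <- divisors n) (n %/ d)%N = sigma n.
Proof.
move=> n_gt0; rewrite -(big_map (fun d => n %/ d)%N predT id).
apply/perm_big/uniq_perm; rewrite ?divisors_uniq //.
  rewrite map_inj_in_uniq ?divisors_uniq // => d e.
  rewrite -!dvdn_divisors // => dn en /(congr1 (divn n)).
  by rewrite !divnA // ?mulKn.
move=> d; rewrite -dvdn_divisors //; apply/mapP/idP => [[e] | dn].
  by rewrite -dvdn_divisors // => en ->; apply: dvdn_div.
exists (n %/ d)%N; first by rewrite -dvdn_divisors // dvdn_div.
by rewrite divnA // mulKn.
Qed.

Lemma sum_prime_divisors n :
  0 < n -> \sum_(d <- divisors n) prime d = omega n.
Proof.
move=> n_gt0; rewrite -big_mkcond sum1_count -size_filter; apply/perm_size.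
apply: uniq_perm; rewrite ?primes_uniq ?filter_uniq ?divisors_uniq // => p.
by rewrite mem_filter mem_primes n_gt0 -dvdn_divisors.
Qed.

(** Only [d = 1] makes [2 * d] prime; its term [n] counts the subgroups generated by a
    reflection. *)
Lemma sum_prime_double_divisors n : 0 < n ->
  \sum_(d <- divisors n) (n %/ d * prime (2 * d))%N = n.
Proof.
move=> n_gt0; rewrite (bigD1_seq 1%N) ?divisor1 ?divisors_uniq //=.
rewrite divn1 muln1 big1_seq ?addn0 // => d /andP[d_neq1].
rewrite -dvdn_divisors // => /(dvdn_gt0 n_gt0) d_gt0.
suff /negPf->: ~~ prime (2 * d) by rewrite muln0.
apply/negP=> /primeP[_ /(_ 2 (dvdn_mulr d (dvdnn 2)))].
by case/pred2P=> // /eqP; rewrite -{1}[2]muln1 eqn_pmul2l // eq_sym (negPf d_neq1).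
Qed.

Theorem proposition2p17 (n : nat) (gT : finGroupType) (G : {group gT}) :
  (1 <= n)%N -> is_dihedral n G ->
  simple_ratio G = ((n + omega n)%N%:R / (tau n + sigma n)%N%:R)%R.
Proof.
move=> n_gt0 /is_dihedralP[] // R [sRG indexR oR cycR invol].
have solG: solvable G.
  have nRG: R <| G by apply: index2_normal.
  rewrite (series_sol nRG) (abelian_sol (cyclic_abelian cycR)) /=.
  apply: abelian_sol; apply: cyclic_abelian; apply: prime_cyclic.
  by rewrite card_quotient ?normal_norm // indexR.
have sumG F : \sum_(H in subgroups G) F #|H| =
    \sum_(d <- divisors n) (F d + n %/ d * F (2 * d))%N.
  by rewrite (sum_subgroups sRG indexR invol) -oR -sum_cyclic_subgroups.
congr (_%:R / _%:R)%R.
  (* The rotation subgroups of prime order give [omega n], the subgroups outside [R] give [n]. *)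
  rewrite /num_simple_subgroups -sum1_card.
  rewrite -sum_prime_divisors // -{1}(sum_prime_double_divisors n_gt0).
  rewrite -big_split /=.
  under [RHS]eq_bigr do rewrite addnC.
  rewrite -(sumG (fun m => prime m : nat)) -big_mkcondr /=.
  apply: eq_bigl => H; rewrite !inE; apply: andb_id2l => sHG.
  by rewrite simple_sol_primeE // (solvableS sHG).
rewrite -sum1_card (sumG (fun=> 1%N)) big_split /= sum1_size.
by under eq_bigr do rewrite muln1; rewrite sum_divn_divisors.
Qed.
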